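(* Let $A$ be $m$-accretive in a real Banach space $X$. Let $K:J=[0,a]\to2^X$ have closed values, put $K_A(t)=K(t)\cap\overline{D(A)}$, and assume $K_A(0)\ne\emptyset$ and that $\mathrm{gr}(K_A)$ is closed from the left. Let $f:\mathrm{gr}(K_A)\to X$, let $D\subset K_A(0)$ be nonempty and bounded, and suppose that there are a null set $N\subset[0,a)$ and finite-valued functions $c,\psi\in L^1_+(J)$ such that - $\|f(t,x)\|\le c(t)(1+\|x\|)$ for all $(t,x)\in\mathrm{gr}(K_A)$; - $f(t,x)\in T_K^A(t,x)$ for all $t\in[0,a)\setminus N$ and $x\in K_A(t)$; - $\liminf_{h\downarrow0}\frac1h\big(d(S(h)x,K_A(t+h))-\int_t^{t+h}\psi(s)\,ds\big)^+=0$ for all $t\in N$ and $x\in K_A(t)$. Then there are a closed-valued map $\widetilde K:J\to2^X$ with $\widetilde K(t)\subset K(t)$ for all $t$, and a finite-valued $\gamma\in L^1_+(J)$ such that, with $\widetilde K_A(t)=\widetilde K(t)\cap\overline{D(A)}$: $D\subset\widetilde K_A(0)$; $\mathrm{gr}(\widetilde K)$ is bounded; $\|f(t,x)\|\le\gamma(t)$ on $\mathrm{gr}(\widetilde K_A)$; $\mathrm{gr}(\widetilde K_A)$ is closed from the left; $$f(t,x)\in T^A_{\widetilde K}(t,x)\quad\text{for all }t\in[0,a)\setminus N\text{ and }x\in\widetilde K_A(t);$$ and $$\liminf_{h\downarrow0}\frac1h\Big(d(S(h)x,\widetilde K_A(t+h))-\int_t^{t+h}\gamma(s)\,ds\Big)^+=0\quad\text{for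 all }t\in N\text{ and }x\in\widetilde K_A(t).$$ Moreover, if $\mathrm{gr}(K_A)$ is product measurable (belongs to $\mathcal L(J)\otimes\mathcal B(X)$), so is $\mathrm{gr}(\widetilde K_A)$.
   Context: A (possibly multivalued) operator $A$ in $X$ has $D(A)=\{x:Ax\ne\emptyset\}$; it is accretive if $\|x-\bar x\|\le\|x-\bar x+\lambda(y-\bar y)\|$ for all $\lambda>0$, $y\in Ax$, $\bar y\in A\bar x$, and $m$-accretive if in addition $R(I+\lambda A)=X$ for all $\lambda>0$. For $m$-accretive $A$, $x\in\overline{D(A)}$ and $w\in L^1([s,b];X)$, $u(\cdot;s,x,w)\in C([s,b];\overline{D(A)})$ denotes the unique mild solution of $u'+Au\ni w$, $u(s)=x$: for every $\varepsilon>0$ there are a partition $s=t_0<\dots<t_N=b$ of mesh $<\varepsilon$, vectors $w_k\in X$ with $\sum_k\int_{t_{k-1}}^{t_k}\|w(t)-w_k\|\,dt<\varepsilon$, and $v_0=x$, $(v_k-v_{k-1})/(t_k-t_{k-1})+Av_k\ni w_k$, such that $u$ is uniformly within $\varepsilon$ of the step function equal to $v_k$ on $(t_{k-1},t_k]$ (and $x$ at $s$). $S(h)x:=u(h;0,x,0)$; for $z\in X$, $S_z(h)x:=u(h;0,x,z)$ (constant forcing $z$). $\mathrm{gr}(K_A)=\{(t,x):x\in K_A(t)\}$ (sections may be empty; $d(x,\emptyset)=\infty$). It is closed from the left if $t_n\nearrow t$, $x_n\in K_A(t_n)$, $x_n\to x$ imply $x\in K_A(t)$. $T_K^A(t,x)=\{z\in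 X:\liminf_{h\downarrow0}h^{-1}d(S_z(h)x,K_A(t+h))=0\}$ for $x\in K_A(t)$. $L^1_+(J)$ denotes nonnegative integrable functions; $\mathcal L(J)$ is the Lebesgue $\sigma$-algebra. *)

(* Defs.v *)
From HB Require Import structures.
From mathcomp Require Import all_boot all_order all_algebra.
From mathcomp Require Import all_classical all_reals all_analysis.
From mathcomp Require Import measurable_realfun.
Set Implicit Arguments.
Unset Strict Implicit.
Unset Printing Implicit Defensive.
Import Order.TTheory GRing.Theory Num.Theory.
Import numFieldNormedType.Exports.
Local Open Scope classical_set_scope.
Local Open Scope ring_scope.

Section operators.
Context {R : realType} {X : completeNormedModType R}.
Implicit Types (A : X -> set X) (K : R -> set X).

Definition op_dom A : set X := [set x | A x !=set0].

Definition accretive A : Prop :=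
  forall (lambda : R) (x x' y y' : X), 0 < lambda -> A x y -> A x' y' ->
    `|x - x'| <= `|x - x' + lambda *: (y - y')|.

Definition m_accretive A : Prop :=
  accretive A /\
  forall (lambda : R) (z : X), 0 < lambda ->
    exists x y : X, A x y /\ x + lambda *: y = z.

(* [u] is a mild solution on [s, b] of u' + A u \ni w, u(s) = x. In
   general w must be Bochner integrable; below w is always a constant, so no
   integrability clause is imposed on it. Values of u and w outside [s, b] are
   irrelevant. *)
Definition mild_solution A (s b : R) (x : X) (w u : R -> X) : Prop :=
  [/\ {within `[s, b], continuous u},
      forall tau, tau \in `[s, b] -> closure (op_dom A) (u tau) &
      forall eps : R, 0 < eps ->
        exists (n : nat) (t : nat -> R) (w_ v : nat -> X),
        [/\ t 0%N = s /\ t n = b,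
            forall k, (k < n)%N -> t k < t k.+1 /\ t k.+1 - t k < eps,
            (\sum_(k < n)
               \int[completed_lebesgue_measure]_(tau in `[t k, t k.+1])
                 `|w tau - w_ k.+1|%:E < eps%:E)%E,
            v 0%N = x /\
            forall k, (k < n)%N ->
              A (v k.+1) (w_ k.+1 - (t k.+1 - t k)^-1 *: (v k.+1 - v k)) &
            `|u s - x| <= eps /\
            forall k tau, (k < n)%N -> tau \in `]t k, t k.+1] ->
              `|u tau - v k.+1| <= eps]].

(* u(.; s, x, w) on [s, b]; unique on [s, b] for m-accretive A and x in the
   closure of D(A). *)
Definition mild_sol A (s b : R) (x : X) (w : R -> X) : R -> X :=
  get [set u | mild_solution A s b x w u].

(* S_z(h) x; S(h) x is the case z = 0. The solution is taken on [0, h]: by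
   uniqueness the value at h does not depend on the right end point. *)
Definition semigroup A (z : X) (h : R) (x : X) : X :=
  mild_sol A 0 h x (cst z) h.

Definition sect A K (t : R) : set X := K t `&` closure (op_dom A).

(* A map K on J = [0, a] is a map on R whose values outside J are ignored. *)
Definition gr (a : R) K : set (R * X) :=
  [set p | p.1 \in `[0, a] /\ K p.1 p.2].

Definition closed_from_left (G : set (R * X)) : Prop :=
  forall (t_ : nat -> R) (x_ : nat -> X) (t : R) (x : X),
    nondecreasing_seq t_ -> t_ @ \oo --> t -> x_ @ \oo --> x ->
    (forall n, G (t_ n, x_ n)) -> G (t, x).

(* [edist_inf B x] is d(x, B), with value +oo on the empty set. For t < a, only
   values K (t + h) with t + h in [0, a] enter the limit inferior. *)
Definition tangent A K (t : R) (x : X) : set X :=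
  [set z | limf_einf (fun h : R => ((h^-1)%:E *
    edist_inf (sect A K (t + h)%R) (semigroup A z h x))%E) 0^'+ = 0%E].

Definition weakly_tangent A K (psi : R -> R) (t : R) (x : X) : Prop :=
  limf_einf (fun h : R => ((h^-1)%:E * maxe 0
    (edist_inf (sect A K (t + h)%R) (semigroup A 0%R h x) -
     \int[completed_lebesgue_measure]_(s in `[t, (t + h)%R]) (psi s)%:E))%E)
    0^'+ = 0%E.

(* Finite-valued representatives of elements of L^1_+([0, a]); measurability is
   Lebesgue (not Borel) measurability. *)
Definition L1_plus (a : R) (c : R -> R) : Prop :=
  (forall t, t \in `[0, a] -> 0 <= c t) /\
  completed_lebesgue_measure.-integrable `[0, a] (EFin \o c).

(* L(J) (x) B(X) for J = [0, a]: the sigma-algebra on J x X generated by the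
   rectangles E x B with E in J Lebesgue measurable, i.e. the union of a Borel
   set and a null set, and B Borel. *)
Definition lebesgue_borel (a : R) : set (set (R * X)) :=
  <<s (`[0, a] `*` [set: X]),
      [set E `*` B | E in [set E : set R | E `<=` `[0, a] /\
                            completed_algebra_gen lebesgue_measure E]
                   & B in <<s @open X >>] >>.

End operators.

(* Main.v *)
(** Fix [(p, q)] in the graph of [A]. The constant [p] is the mild solution with
    forcing [q], so that [`|S_z(h) x - p| <= `|x - p| + h * `|z - q|]. Put
    [K' t = K t `&` {x | `|x - p| <= rho t}]. A point of [K (t + h)] close to
    [S_z(h) x], with [x] in [K' t], then lies in [K' (t + h)] provided that [rho]
    grows fast enough on [[t, t + h]]. This holds for
    [rho t = C * expR (t + \int_(0, t) psi + r t) - (1 + `|p|)], where [r] is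
    nondecreasing and [r (t + h) - r t >= h * c t] for all small [h], at every
    [t] and not only almost everywhere.

    Since [semigroup] is defined by choice, nothing is known about it until mild
    solutions are shown to exist: they are obtained as limits of implicit Euler
    schemes, by the Crandall-Liggett theorem with Kobayashi's estimate. *)
Require Import Defs.
From mathcomp Require Import all_boot all_order all_algebra.
From mathcomp Require Import all_classical all_reals all_analysis.
From mathcomp Require Import measurable_realfun ring lra.
Set Implicit Arguments.
Unset Strict Implicit.
Unset Printing Implicit Defensive.
Import Order.TTheory GRing.Theory Num.Theory.
Import numFieldNormedType.Exports.
Local Open Scope classical_set_scope.
Local Open Scope ring_scope.

(** * Mild solutions *)

Lemma truncn_mul_near {R : archiRealFieldType} (l t : R) : 0 < l -> 0 <= t ->
  `|(Num.truncn (t / l))%:R * l - t| <= l.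
Proof.
move=> l0 t0; have /andP[h1 h2] := truncn_itv (divr_ge0 t0 (ltW l0)).
rewrite ler_norml; move: h1 h2.
rewrite ler_pdivlMr// ltr_pdivrMr// -natr1 mulrDl mul1r => h1 h2.
by apply/andP; split; lra.
Qed.

(** The extra step makes the Euler iterate a value of the resolvent, hence a point of the domain,
    even for [t = 0]. *)
Lemma truncnS_mul_near {R : archiRealFieldType} (l t : R) : 0 < l -> 0 <= t ->
  `|(Num.truncn (t / l)).+1%:R * l - t| <= l.
Proof.
move=> l0 t0; have /andP[h1 h2] := truncn_itv (divr_ge0 t0 (ltW l0)).
rewrite ler_norml; move: h1 h2.
rewrite ler_pdivlMr// ltr_pdivrMr// -natr1 mulrDl mul1r => h1 h2.
by apply/andP; split; lra.
Qed.

Lemma integral_cst_completed {R : realType} (a b r : R) : a <= b ->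
  (\int[completed_lebesgue_measure]_(x in `[a, b]) r%:E = (r * (b - a))%:E)%E.
Proof.
move=> ab; rewrite integral_cst; last first.
  by apply: sub_caratheodory; exact: measurable_itv.
rewrite EFinM; congr (_ * _)%E.
rewrite -[LHS]/(lebesgue_measure `[a, b]%classic) lebesgue_measure_itv/= lte_fin.
by case: ltgtP ab => // -> _; rewrite subrr.
Qed.

(** * Accretivity inequalities and resolvents *)

Section accretive_operators.
Context {R : realType} {X : completeNormedModType R}.
Implicit Types (A : X -> set X) (x u v y z : X) (l m : R).

(** Accretivity is applied with parameter [l * m / (l + m)]: multiplied by [l + m], the vector on
    its right-hand side becomes [m *: (x0 - u1) + l *: (x1 - u0)]. *)
Lemma accretive_kobayashi A l m x0 x1 u0 u1 : accretive A -> 0 < l -> 0 < m ->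
  A x1 (l^-1 *: (x0 - x1)) -> A u1 (m^-1 *: (u0 - u1)) ->
  (l + m) * `|x1 - u1| <= m * `|x0 - u1| + l * `|x1 - u0|.
Proof.
move=> acc l0 m0 Ax Au.
have lm0 : 0 < l + m by rewrite addr_gt0.
have nu0 : 0 < l * m / (l + m) by rewrite divr_gt0 ?mulr_gt0.
have := acc _ _ _ _ _ nu0 Ax Au.
have -> : x0 - u1 = (x0 - x1) + (x1 - u1) by rewrite addrA subrK.
have -> : x1 - u0 = (x1 - u1) - (u0 - u1) by rewrite opprB addrA subrK.
set a := x0 - x1; set b := u0 - u1; set w := x1 - u1 => h.
rewrite -(ler_pM2l lm0) in h; apply: le_trans h _.
have nZ k z : 0 < k -> k * `|z| = `|k *: z| by move=> k0; rewrite normrZ gtr0_norm.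
rewrite !nZ//; apply: le_trans (ler_normD _ _).
rewrite le_eqVlt; apply/orP; left; apply/eqP; congr `|_|.
move: a b w => a b w.
rewrite scalerDr scalerA (mulrC (l + m)) divfK ?gt_eqF// (scalerBr (l * m)).
rewrite !scalerA (mulrAC l) divff ?gt_eqF// mul1r mulfK ?gt_eqF//.
by rewrite scalerDl (addrC (l *: w)) addrACA -scalerDr -scalerBr (addrC w).
Qed.

Lemma accretive_resolvent_le A l x0 x1 u v : accretive A -> 0 < l ->
  A x1 (l^-1 *: (x0 - x1)) -> A u v -> `|x1 - u| <= `|x0 - u - l *: v|.
Proof.
move=> acc l0 Ax Au; apply: le_trans (acc _ _ _ _ _ l0 Ax Au) _.
rewrite scalerBr scalerA divff ?gt_eqF// scale1r.
by rewrite addrA (addrC (x1 - u)) addrA subrK.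
Qed.

Lemma accretive_resolvent_nonexpansive A l x0 x1 u0 u1 : accretive A -> 0 < l ->
  A x1 (l^-1 *: (x0 - x1)) -> A u1 (l^-1 *: (u0 - u1)) ->
  `|x1 - u1| <= `|x0 - u0|.
Proof.
move=> acc l0 Ax Au; have := accretive_resolvent_le acc l0 Ax Au.
by rewrite scalerA divff ?gt_eqF// scale1r opprB addrA subrK.
Qed.

(** For [0 < l], [J l] is the resolvent, the inverse of [I + l A]. *)
Lemma m_accretive_resolvent A : m_accretive A ->
  exists J : R -> X -> X, forall l x, 0 < l -> A (J l x) (l^-1 *: (x - J l x)).
Proof.
move=> [_ Asurj].
have /choice[J JA] : forall lx : R * X, exists w : X,
    0 < lx.1 -> A w (lx.1^-1 *: (lx.2 - w)).
  move=> [l x] /=; have [l0|_] := boolP (0 < l); last by exists x.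
  have [w [y [Awy <-]]] := Asurj _ x l0.
  by exists w => _; rewrite [w + _]addrC addrK scalerA mulVf ?gt_eqF// scale1r.
by exists (fun l x => J (l, x)) => l x; exact: (JA (l, x)).
Qed.

(** A constant forcing is absorbed into the operator: $u' + Au \ni z$ becomes $u' + (A - z)u \ni
    0$. *)
Lemma m_accretive_shift A z : m_accretive A -> m_accretive (fun x y => A x (y + z)).
Proof.
move=> [acc Asurj]; split => [l x x' y y' l0 Ax Ax'|l w l0].
  by have := acc _ _ _ _ _ l0 Ax Ax'; rewrite opprD addrACA subrr addr0.
have [x [y [Axy xyw]]] := Asurj _ (w + l *: z) l0.
exists x, (y - z); rewrite subrK; split => //.
by rewrite scalerBr addrA xyw addrK.
Qed.

(** * Implicit Euler schemes and their limit *)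

Section euler.
Variables (A : X -> set X) (J : R -> X -> X).
Hypotheses (acc : accretive A)
  (JA : forall l x, 0 < l -> A (J l x) (l^-1 *: (x - J l x))).

Lemma euler_nonexpansive l n x x' : 0 < l ->
  `|iter n (J l) x - iter n (J l) x'| <= `|x - x'|.
Proof.
move=> l0; elim: n => //= n; apply: le_trans.
by apply: accretive_resolvent_nonexpansive (JA _ l0) (JA _ l0).
Qed.

Lemma euler_dist_start l n x y : 0 < l -> A x y ->
  `|iter n (J l) x - x| <= n%:R * l * `|y|.
Proof.
move=> l0 Axy; elim: n => [|n IHn]/=; first by rewrite subrr normr0 !mul0r.
apply: le_trans (accretive_resolvent_le acc l0 (JA _ l0) Axy) _.
apply: le_trans (ler_normB _ _) _.
by rewrite normrZ gtr0_norm// -natr1 !mulrDl mul1r lerD2r.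
Qed.

(* The radicand [D m n] satisfies
   [(l + k) * D m n = k * D m.-1 n + l * D m n.-1], so that, the square root
   being concave, the recursion of [accretive_kobayashi] propagates the bound. *)
Lemma euler_dist l (k : R) (m n : nat) x y : 0 < l -> 0 < k -> A x y ->
  `|iter m (J l) x - iter n (J k) x| <=
  `|y| * Num.sqrt ((m%:R * l - n%:R * k) ^+ 2 + m%:R * l ^+ 2 + n%:R * k ^+ 2).
Proof.
move=> l0 k0 Axy.
pose D i j : R := (i%:R * l - j%:R * k) ^+ 2 + i%:R * l ^+ 2 + j%:R * k ^+ 2.
have D0 i j : 0 <= D i j.
  by rewrite !addr_ge0 ?sqr_ge0// mulr_ge0// ?ler0n ?sqr_ge0.
have le_sqrtD c i j : 0 <= c -> c ^+ 2 <= D i j -> c <= Num.sqrt (D i j).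
  by move=> c0 cD; rewrite -(ger0_norm c0) -sqrtr_sqr ler_sqrt.
rewrite -/(D m n); elim: m n => [n|m IHm].
  rewrite distrC (le_trans (euler_dist_start _ k0 Axy))// mulrC ler_wpM2l//.
  apply: le_sqrtD; first by rewrite mulr_ge0// ltW.
  by rewrite /D !mul0r sub0r sqrrN addr0 lerDl mulr_ge0// sqr_ge0.
elim=> [|n IHn].
  rewrite (le_trans (euler_dist_start _ l0 Axy))// mulrC ler_wpM2l//.
  apply: le_sqrtD; first by rewrite mulr_ge0// ltW.
  by rewrite /D !mul0r subr0 addr0 lerDl mulr_ge0// sqr_ge0.
have lk0 : 0 < l + k by rewrite addr_gt0.
rewrite -(ler_pM2l lk0).
apply: le_trans (accretive_kobayashi acc l0 k0 (JA _ l0) (JA _ k0)) _ => /=.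
have h1 := IHm n.+1; rewrite /= -(ler_pM2l k0) in h1.
have h2 := IHn; rewrite /= -(ler_pM2l l0) in h2.
apply: le_trans (lerD h1 h2) _; rewrite !(mulrCA _ `|y|) -mulrDr ler_wpM2l//.
have := D0 m n.+1; have := D0 m.+1 n; have := D0 m.+1 n.+1.
set s := Num.sqrt (D m n.+1); set t := Num.sqrt (D m.+1 n) => d1 d2 d3.
have s2 : s ^+ 2 = D m n.+1 by rewrite sqr_sqrtr.
have t2 : t ^+ 2 = D m.+1 n by rewrite sqr_sqrtr.
have s0 : 0 <= s by rewrite sqrtr_ge0.
have t0 : 0 <= t by rewrite sqrtr_ge0.
rewrite -ler_pdivrMl//; apply: le_sqrtD.
  apply: mulr_ge0; first by rewrite invr_ge0 ltW.
  by apply: addr_ge0; apply: mulr_ge0; rewrite // ltW.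
have -> : D m.+1 n.+1 = (l + k)^-1 * (k * s ^+ 2 + l * t ^+ 2).
  rewrite s2 t2 /D -!natr1; by field; rewrite gt_eqF.
rewrite -subr_ge0.
have -> : (l + k)^-1 * (k * s ^+ 2 + l * t ^+ 2) - ((l + k)^-1 * (k * s + l * t)) ^+ 2
   = l * k * (s - t) ^+ 2 / (l + k) ^+ 2.
  by field; rewrite gt_eqF.
by rewrite divr_ge0 ?sqr_ge0// mulr_ge0 ?sqr_ge0// mulr_ge0// ltW.
Qed.

(** A point [x'] of the domain within [e / 3] of [x] replaces it in both iterates, by
    nonexpansiveness; [euler_dist] treats the iterates of [x']. *)
Lemma euler_equicontinuous x (T e : R) : closure (op_dom A) x -> 0 <= T -> 0 < e ->
  exists2 d, 0 < d & forall (l k : R) (m n : nat), 0 < l < d -> 0 < k < d ->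
    m%:R * l <= T -> n%:R * k <= T -> `|m%:R * l - n%:R * k| < d ->
    `|iter m (J l) x - iter n (J k) x| <= e.
Proof.
move=> clx T0 e0; have e30 : 0 < e / 3 by rewrite divr_gt0.
have [x' [[y Axy]]] := clx _ (nbhsx_ballx x _ e30).
rewrite -ball_normE/= => xx'.
(* For [d <= 1] the radicand of [euler_dist] is at most [d * (1 + 2 * T)], so the squared bound is
   at most [d * M]; the [+ 1] keeps [M] positive when [y = 0]. *)
pose M := (`|y| ^+ 2 + 1) * (1 + 2 * T).
have M0 : 0 < M.
  apply: mulr_gt0; first by rewrite ltr_wpDl ?sqr_ge0.
  by rewrite ltr_pwDl// mulr_ge0.
exists (Num.min 1 ((e / 3) ^+ 2 / M)).
  by rewrite lt_min ltr01 divr_gt0 ?exprn_gt0.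
move=> l k m n /andP[l0 ld] /andP[k0 kd] mlT nkT mnd.
set d := Num.min _ _ in ld kd mnd.
have d0 : 0 < d by rewrite (lt_trans l0).
have d1 : d <= 1 by rewrite ge_min lexx.
have dM : d * M <= (e / 3) ^+ 2 by rewrite -ler_pdivlMr// ge_min lexx orbT.
have -> : iter m (J l) x - iter n (J k) x =
    (iter m (J l) x - iter m (J l) x') + (iter m (J l) x' - iter n (J k) x')
     + (iter n (J k) x' - iter n (J k) x).
  by rewrite !subrKA.
have -> : e = e / 3 + e / 3 + e / 3 by field.
apply: le_trans (ler_normD _ _) _; apply: lerD; last first.
  by rewrite (le_trans (euler_nonexpansive _ _ _ k0))// distrC ltW.
apply: le_trans (ler_normD _ _) _; apply: lerD.
  by rewrite (le_trans (euler_nonexpansive _ _ _ l0))// ltW.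
apply: le_trans (euler_dist m n l0 k0 Axy) _.
rewrite -(@ler_pXn2r _ 2)// ?nnegrE.
  2: by rewrite mulr_ge0 ?sqrtr_ge0.
  2: exact: ltW.

rewrite exprMn sqr_sqrtr; last first.
  by rewrite !addr_ge0 ?sqr_ge0// mulr_ge0// ?ler0n ?sqr_ge0.
apply: le_trans dM; rewrite /M (mulrCA d).
apply: ler_pM; rewrite ?sqr_ge0//.
- by rewrite !addr_ge0 ?sqr_ge0// mulr_ge0// ?ler0n ?sqr_ge0.
- by rewrite lerDl.
rewrite mulrDr mulr1 -addrA; apply: lerD.
  rewrite -real_normK ?num_real// expr2.
  by rewrite -[leRHS]mulr1; apply: ler_pM (ltW mnd) (le_trans (ltW mnd) d1).
have -> : d * (2 * T) = T * d + T * d by ring.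
have lek (i : nat) (s : R) : 0 < s -> s < d -> i%:R * s <= T ->
    i%:R * s ^+ 2 <= T * d.
  move=> s0 sd iT; rewrite expr2 mulrA.
  apply: ler_pM iT (ltW sd); last exact: ltW.
  by rewrite mulr_ge0// ltW.
exact: lerD (lek _ _ l0 ld mlT) (lek _ _ k0 kd nkT).
Qed.


(** This one uniform estimate yields every clause of [mild_solution]: continuity, values in the
    closure of the domain, and discrete approximations. *)
Lemma euler_limit x (T : R) : closure (op_dom A) x -> 0 < T ->
  exists u : R -> X, forall e : R, 0 < e -> exists2 d, 0 < d &
    forall l n (t : R), 0 < l < d -> t \in `[0, T] -> `|n%:R * l - t| < d ->
    `|u t - iter n (J l) x| <= e.
Proof.
move=> clx T0; have T10 : 0 <= T + 1 by rewrite addr_ge0// ltW.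
pose l_ k : R := harmonic k.
have l_gt0 k : 0 < l_ k by rewrite /l_ /harmonic/= invr_gt0.
pose i_ t k := Num.truncn (t / l_ k).
pose P t k := iter (i_ t k) (J (l_ k)) x.
have i_P (t : R) k : 0 <= t -> `|(i_ t k)%:R * l_ k - t| <= l_ k.
  exact: truncn_mul_near.
have lsmall (d : R) : 0 < d -> \forall k \near \oo, l_ k < d.
  move=> d0; exact: (@cvgr_lt _ _ _ _ _ _ (@cvg_harmonic R)).
have step (e : R) : 0 < e -> exists2 d, 0 < d & forall l n (t : R),
    0 < l < d -> t \in `[0, T] -> `|n%:R * l - t| < d ->
    \forall k \near \oo, `|P t k - iter n (J l) x| <= e.
  move=> e0; have [d d0 dP] := euler_equicontinuous clx T10 e0.
  (* Two elapsed times within [d / 2] of [t] differ by less than [d]; the bound [1] keeps them below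
     [T + 1], where equicontinuity was invoked. *)
  pose d' := Num.min (d / 2) 1.
  have d'0 : 0 < d' by rewrite lt_min ltr01 divr_gt0.
  exists d' => // l n t /andP[l0 ld]; rewrite in_itv/= => /andP[t0 tT] nld.
  near=> k.
  have lkd : l_ k < d' by near: k; exact: lsmall.
  have := i_P t k t0; move: nld ld lkd; rewrite !lt_min.
  move=> /andP[n1 n2] /andP[l1 l2] /andP[k1 k2] ik.
  move: n1 n2 ik; rewrite !ltr_norml !ler_norml.
  move=> /andP[n1 n3] /andP[n2 n4] /andP[i1 i2].
  apply: dP; rewrite ?l_gt0 ?l0 ?ltr_norml; lra.
pose u t := limn (P t).
have Pcvg (t : R) : t \in `[0, T] -> P t @ \oo --> u t.
  move=> tT; apply: cauchy_cvg; apply: cauchy_exP => e e0.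
  have [d d0 dP] := step _ (divr_gt0 e0 (ltr0n _ 2)).
  have : \forall k \near \oo, l_ k < d by exact: lsmall.
  move=> [k _ kP]; have lkd := kP k (leqnn k).
  exists (P t k); have t0 : 0 <= t by move: tT; rewrite in_itv => /andP[].
  have : \forall j \near \oo, `|P t j - P t k| <= e / 2.
    apply: dP => //; first by rewrite l_gt0.
    by rewrite (le_lt_trans (i_P t k t0)).
  apply: filterS => j; rewrite -ball_normE/= distrC => /le_lt_trans; apply.
  by rewrite gtr_pMr// invf_lt1// ltr1n.
exists u => e e0; have [d d0 dP] := step _ e0; exists d => // l n t ld tT nld.
have uc : (fun k => `|P t k - iter n (J l) x|) @ \oo --> `|u t - iter n (J l) x|.
  by apply: cvg_norm; apply: cvgB; [exact: Pcvg|exact: cvg_cst].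
exact: (@cvgr_to_le _ _ _ _ _ _ _ uc (dP l n t ld tT nld)).
Unshelve. all: end_near. Qed.

End euler.

(** * Existence of mild solutions and comparison with stationary ones *)

Lemma mild_solution_exists A x (T : R) z : m_accretive A ->
  closure (op_dom A) x -> 0 < T -> exists u : R -> X, mild_solution A 0 T x (cst z) u.
Proof.
move=> hA clx T0; pose B x y := A x (y + z).
have [accB _] := m_accretive_shift z hA; rewrite -/B in accB.
have [J JB] := m_accretive_resolvent (m_accretive_shift z hA).
have domE : op_dom B = op_dom A.
  apply/seteqP; split => w [y Ay]; first by exists (y + z).
  by exists (y - z); rewrite /B/= subrK.
have clBx : closure (op_dom B) x by rewrite domE.
have [u uP] := euler_limit accB JB clBx T0; exists u; split.
- apply/subspace_continuousP => t tT; apply/cvgrPdist_le => e e0.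
  have [d d0 dP] := uP _ (divr_gt0 e0 (ltr0n _ 2)).
  rewrite near_withinE; near=> s => sT.
  have ts : `|t - s| < d / 2 by near: s; apply: cvgr_dist_lt => //; rewrite divr_gt0.
  (* A single iterate, with elapsed time within [d] of both [t] and [s], approximates [u t] and
     [u s]. *)
  pose l := d / 4; have l0 : 0 < l by rewrite divr_gt0.
  have t0 : 0 <= t by move: tT; rewrite /= in_itv/= => /andP[].
  have := truncn_mul_near l0 t0; set n := Num.truncn _ => nl.
  have ld : 0 < l < d by rewrite l0 /l; lra.
  have ut : `|u t - iter n (J l) x| <= e / 2.
    by apply: dP => //; rewrite (le_lt_trans nl)//; case/andP: ld.
  have us : `|u s - iter n (J l) x| <= e / 2.
    apply: dP => //; move: nl ts; rewrite ler_norml !ltr_norml /l.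
    by move=> /andP[n1 n2] /andP[n3 n4]; apply/andP; split; lra.
  rewrite -(subrKA (iter n (J l) x)) (le_trans (ler_normD _ _))//.
  by rewrite (splitr e) lerD// distrC.
- move=> t tT; rewrite -domE => V /nbhs_ballP[e /= e0 eV].
  have [d d0 dP] := uP _ (divr_gt0 e0 (ltr0n _ 2)).
  pose l := d / 2; have l0 : 0 < l by rewrite divr_gt0.
  have t0 : 0 <= t by move: tT; rewrite /= in_itv/= => /andP[].
  have := truncnS_mul_near l0 t0; set n := Num.truncn _ => nl.
  have ld : l < d by rewrite /l; lra.
  exists (iter n.+1 (J l) x); split.
    by eexists; exact: JB.
  apply: eV; rewrite -ball_normE/=.
  apply: (@le_lt_trans _ _ (e / 2)); last by rewrite ltr_pdivrMr// ltr_pMr// ltr1n.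
  by apply: (dP l n.+1) => //; rewrite ?l0// (le_lt_trans nl).
- move=> e e0; have [d d0 dP] := uP _ e0.
  pose m := Num.min d e; have m0 : 0 < m by rewrite lt_min d0.
  (* The [n.+1] equal steps end exactly at [T], and [l < m] because [T / m < n.+1]. *)
  pose n := Num.truncn (T / m); pose l := T / n.+1%:R.
  have l0 : 0 < l by rewrite divr_gt0.
  have lm : l < m.
    have /andP[_] := truncn_itv (divr_ge0 (ltW T0) (ltW m0)).
    by rewrite -/n /l !ltr_pdivrMr// mulrC.
  have dt k : k.+1%:R * l - k%:R * l = l by rewrite -mulrBl -natrB// subSnn mul1r.
  exists n.+1, (fun k => k%:R * l), (fun=> z), (fun k => iter k (J l) x); split.
  + by rewrite mul0r /l mulrC divfK.
  + move=> k _; rewrite dt -subr_gt0 dt l0; split => //.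
    by rewrite (lt_le_trans lm)// ge_min lexx orbT.
  + rewrite big1 ?lte_fin// => k _ /=.
    under eq_integral do rewrite subrr normr0.
    by rewrite integral0.
  + split => // k _; rewrite dt -scalerN opprB.
    by have := JB l (iter k (J l) x) l0; rewrite /B addrC.
  + have ld : 0 < l < d by rewrite l0 (lt_le_trans lm)// ge_min lexx.
    split.
      apply: (dP l 0%N 0) ld _ _; last by rewrite mul0r subrr normr0.
      by rewrite in_itv/= lexx ltW.
    move=> k t kn; rewrite in_itv/= => /andP[t1 t2]; apply: (dP l k.+1) => //.
      rewrite in_itv/= (le_trans _ (ltW t1))/=; last by rewrite mulr_ge0// ltW.
      rewrite (le_trans t2)// /l mulrA ler_pdivrMr// mulrC ler_pM2l//.
      by rewrite ler_nat.
    rewrite ger0_norm ?subr_ge0//; move: t1; rewrite -ltrN2 => t1.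
    case/andP: ld => _; apply: lt_trans.
    by rewrite -[ltRHS](dt k) ltrD2l.
Unshelve. all: end_near. Qed.

(* The constant function [p] is the mild solution with forcing [q], so this is
   the comparison estimate for two mild solutions, one of which is constant. *)
Lemma mild_solution_dist A x (h : R) z (u : R -> X) p q : accretive A -> 0 < h ->
  mild_solution A 0 h x (cst z) u -> A p q ->
  `|u h - p| <= `|x - p| + h * `|z - q|.
Proof.
move=> acc h0 [_ _ uP] Apq; apply/ler_addgt0Pr => e e0.
have [n [t [w [v [[t0 tn] dt we [v0 vA] [_ uv]]]]]] := uP _ (divr_gt0 e0 (ltr0n _ 2)).
have vk k : (k <= n)%N -> `|v k - p| <= `|x - p| + t k * `|z - q| +
    \sum_(i < k) `|z - w i.+1| * (t i.+1 - t i).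
  elim: k => [_|k IHk kn]; first by rewrite v0 t0 mul0r big_ord0 !addr0.
  have [tk _] := dt _ kn; rewrite -subr_gt0 in tk.
  apply: le_trans (acc _ _ _ _ _ tk (vA _ kn) Apq) _.
  set s := t k.+1 - t k in tk *.
  (* With the step [s] as parameter of accretivity, [v k.+1] cancels; the previous value, the drift
     [z - q] and the forcing error remain. *)
  have -> : v k.+1 - p + s *: (w k.+1 - s^-1 *: (v k.+1 - v k) - q) =
      (v k - p) + (s *: (z - q) + s *: (w k.+1 - z)).
    rewrite (addrAC (w k.+1)) (scalerBr s _ (_ *: _)) scalerA divff ?gt_eqF//.
    rewrite scale1r opprB -scalerDr (addrC (z - q)) subrKA.
    by rewrite (addrC (s *: _)) addrA (addrC (_ - p)) subrKA.
  rewrite big_ord_recr/= -/s.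
  apply: le_trans (ler_normD _ _) _.
  have := ler_normD (s *: (z - q)) (s *: (w k.+1 - z)).
  rewrite !normrZ gtr0_norm// (distrC (w _)).
  have -> : t k.+1 = t k + s by rewrite /s addrC subrK.
  have := IHk (ltnW kn); rewrite (mulrDl (t k)) (mulrC _ s) => h1 h2.
  by apply: le_trans (lerD h1 h2) _; rewrite addrACA (addrA `|x - p|).
(* A last subinterval exists, since [n = 0] would give [h = 0]; its closed right end is [h]. *)
have n0 : (0 < n)%N.
  by rewrite lt0n; apply: contraPneq h0 => n0; rewrite -tn n0 t0 ltxx.
case: n n0 t0 tn dt we vA uv vk => // n _ t0 tn dt we vA uv vk.
have un : `|u h - v n.+1| <= e / 2.
  apply: uv => //; rewrite in_itv/= tn lexx andbT -tn.
  by have [] := dt _ (ltnSn n).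
have wn : \sum_(i < n.+1) `|z - w i.+1| * (t i.+1 - t i) < e / 2.
  rewrite -lte_fin -sumEFin; apply: le_lt_trans we; apply: lee_sum => i _.
  have [ti _] := dt _ (ltn_ord i).
  by rewrite /= integral_cst_completed// ltW.
rewrite -(subrKA (v n.+1)) (le_trans (ler_normD _ _))//.
have := vk _ (leqnn _); rewrite tn; lra.
Qed.

(** A mild solution exists, so [get] returns one, and the comparison holds for whichever is
    chosen. *)
Lemma semigroup_dist A x (h : R) z p q : m_accretive A -> closure (op_dom A) x ->
  0 < h -> A p q -> `|semigroup A z h x - p| <= `|x - p| + h * `|z - q|.
Proof.
move=> hA clx h0; apply: mild_solution_dist => //; first by case: hA.
apply: (@getPex _ [set u | mild_solution A 0 h x (cst z) u]).
exact: mild_solution_exists.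
Qed.

End accretive_operators.

(** * Tangency conditions *)

Section right_liminf.
Context {R : realType}.

Lemma limf_einf_right_eq0 (F : R -> \bar R) :
  (forall h, 0 < h -> (0 <= F h)%E) ->
  limf_einf F 0^'+ = 0%E <->
  forall e d : R, 0 < e -> 0 < d -> exists2 h, 0 < h < d & (F h < e%:E)%E.
Proof.
move=> F0; rewrite limf_einfE; split => [supF e d e0 d0|F_small].
  have /ereal_inf_lt[_ [h hd <-] Fh] :
      (ereal_inf (F @` [set h | (0 < h < d)%R]) < e%:E)%E.
    apply: (@le_lt_trans _ _ 0%E); last by rewrite lte_fin.
    rewrite -supF; apply: ereal_sup_ubound; exists [set h | 0 < h < d] => //.
    near=> h; apply/andP.
    by split; near: h; [exact: nbhs_right_gt|exact: nbhs_right_lt].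
  by exists h.
apply/eqP; rewrite eq_le; apply/andP; split.
  apply: ge_ereal_sup => _ [V V0 <-]; apply/lee_addgt0Pr => e e0; rewrite add0e.
  have [d d0 dV] : exists2 d : R, 0 < d & forall h, 0 < h < d -> V h.
    case: V0 => d /= d0 dV; exists d => // h /andP[h0 hd]; apply: dV => //=.
    by rewrite sub0r normrN gtr0_norm.
  have [h hd Fh] := F_small _ _ e0 d0.
  by apply: le_trans (ltW Fh); apply: ereal_inf_lbound; exists h => //; exact: dV.
apply: (@le_trans _ _ (ereal_inf (F @` [set h | (0 < h)%R]))).
  by apply: le_ereal_inf_tmp => _ [h h0 <-]; exact: F0.
apply: ereal_sup_ubound; exists [set h | 0 < h] => //.
exact: nbhs_right_gt.
Unshelve. all: by end_near. Qed.

Lemma edist_inf_lt {X : normedModType R} (B : set X) (x : X) (r : R) :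
  (edist_inf B x < r%:E)%E <-> exists2 y, B y & `|x - y| < r.
Proof.
split => [/ereal_inf_lt[_ [y By <-] /edist_lt_ball]|[y By xyr]].
  by rewrite -ball_normE/= => xy; exists y.
(* Lying in a ball bounds [edist] only non-strictly, hence a radius strictly below [r]. *)
pose s := (`|x - y| + r) / 2.
have s0 : 0 < s by rewrite divr_gt0// ltr_wpDl// (le_lt_trans _ xyr).
apply: (@le_lt_trans _ _ s%:E); last by rewrite lte_fin /s; lra.
apply: (@le_trans _ _ (edist (x, y))).
  by apply: ereal_inf_lbound; exists y.
apply: edist_fin => //=; rewrite -ball_normE/= /s; lra.
Qed.

End right_liminf.

Section tangency.
Context {R : realType} {X : completeNormedModType R}.
Implicit Types (A : X -> set X) (K : R -> set X).

(** An empty section is at distance [+oo], so a small quotient already supplies [y]. *)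
Lemma tangentP A K (t : R) (x z : X) : tangent A K t x z <->
  forall e d : R, 0 < e -> 0 < d -> exists h y, [/\ 0 < h < d,
    sect A K (t + h) y & `|semigroup A z h x - y| < h * e].
Proof.
rewrite /tangent /= limf_einf_right_eq0; last first.
  move=> h h0; apply: mule_ge0; first by rewrite lee_fin invr_ge0 ltW.
  exact: edist_inf_ge0.
have dE (h e : R) : 0 < h -> ((h^-1)%:E * edist_inf (sect A K (t + h)%R)
    (semigroup A z h x) < e%:E)%E <->
    exists2 y, sect A K (t + h) y & `|semigroup A z h x - y| < h * e.
  by move=> h0; rewrite lte_pdivrMl// -EFinM edist_inf_lt.
split=> P e d e0 d0.
  have [h /andP[h0 hd] /(dE _ _ h0)[y Ky xy]] := P e d e0 d0.
  by exists h, y; rewrite h0.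
have [h [y [/andP[h0 hd] Ky xy]]] := P e d e0 d0.
by exists h; [rewrite h0|apply/dE => //; exists y].
Qed.

(** The positive part drops out because it is compared with [h * e > 0]. The bound [t + h < a] makes
    the integral of [psi] finite, so that it can cross the inequality. *)
Lemma weakly_tangentP A K (a : R) (psi : R -> R) (t : R) (x : X) :
  L1_plus a psi -> t \in `[0, a[ -> weakly_tangent A K psi t x <->
  forall e d : R, 0 < e -> 0 < d -> exists h y, [/\ 0 < h < d, t + h < a,
    sect A K (t + h) y & `|semigroup A 0 h x - y| <
      \int[completed_lebesgue_measure]_(s in `[t, t + h]) psi s + h * e].
Proof.
move=> [psi0 psiL1]; rewrite in_itv/= => /andP[t0 ta].
rewrite /weakly_tangent /= limf_einf_right_eq0; last first.
  move=> h h0; apply: mule_ge0; first by rewrite lee_fin invr_ge0 ltW.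
  by rewrite le_max lexx.
have at0 : 0 < a - t by rewrite subr_gt0.
have dE (h e : R) : 0 < h -> t + h < a -> 0 < e ->
    ((h^-1)%:E * maxe 0 (edist_inf (sect A K (t + h)%R) (semigroup A 0%R h x) -
     \int[completed_lebesgue_measure]_(s in `[t, (t + h)%R]) (psi s)%:E) < e%:E)%E
    <-> exists2 y, sect A K (t + h) y & `|semigroup A 0 h x - y| <
      \int[completed_lebesgue_measure]_(s in `[t, t + h]) psi s + h * e.
  move=> h0 tha e0; rewrite lte_pdivrMl// -EFinM gt_max lte_fin mulr_gt0//=.
  rewrite -edist_inf_lt /Rintegral; set I := (\int[_]_(_ in _) _)%E.
  have I_fin : I \is a fin_num.
    apply: integrable_fin_num.
      by apply: sub_caratheodory; exact: measurable_itv.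
    apply: integrableS psiL1; try by apply: sub_caratheodory; exact: measurable_itv.
    by apply: subset_itv; rewrite bnd_simp// ltW.
  by rewrite lteBlDr// EFinD fineK// addeC.
split=> P e d e0 d0.
  have m0 : 0 < Num.min d (a - t) by rewrite lt_min d0.
  have [h] := P e _ e0 m0; rewrite lt_min ltrBrDl => /and3P[h0 hd hta].
  by move=> /(dE _ _ h0 hta e0)[y Ky xy]; exists h, y; rewrite h0.
have [h [y [/andP[h0 hd] tha Ky xy]]] := P e d e0 d0.
by exists h; [rewrite h0|apply/dE => //; exists y].
Qed.

End tangency.

(** * Growth of integrals *)

Section growth.
Context {R : realType}.
Notation mu := (@completed_lebesgue_measure R).
Notation completed := ((@wlength R idfun)^*%mu.-cara.-measurable).

Lemma measurable_completed (E : set R) : measurable E -> completed E.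
Proof. by move=> mE; exact: sub_caratheodory. Qed.

Lemma Rintegral_itv_cat (a t h : R) (psi : R -> R) :
  mu.-integrable `[0, a] (EFin \o psi) -> 0 <= t -> 0 <= h -> t + h <= a ->
  \int[mu]_(s in `[0, t + h]) psi s =
  \int[mu]_(s in `[0, t]) psi s + \int[mu]_(s in `[t, t + h]) psi s.
Proof.
move=> ipsi t0 h0 tha.
have mitv (i : interval R) : completed [set` i].
  by apply: measurable_completed; exact: measurable_itv.
have isub (i : interval R) : [set` i] `<=` `[0, a]%classic ->
    mu.-integrable [set` i] (EFin \o psi).
  by move=> ia; apply: integrableS ipsi.
have e1 : `[0, t + h]%classic = `[0, t]%classic `|` `]t, t + h]%classic.
  apply/seteqP; split=> s /=; rewrite !in_itv/=.
    by move=> /andP[-> ->]; case: leP; [left|right].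
  move=> [/andP[-> st]|/andP[ts ->]]/=; first by rewrite (le_trans st)// lerDl.
  by rewrite andbT (le_trans t0)// ltW.
have e2 : `[t, t + h]%classic = [set t] `|` `]t, t + h]%classic.
  apply/seteqP; split=> s /=; rewrite !in_itv/=.
    by move=> /andP[+ ->]; rewrite le_eqVlt => /predU1P[->|->]; [left|right].
  by move=> [->|/andP[ts ->]]; rewrite ?lexx ?lerDl// ltW.
have mt : completed [set t] by apply: measurable_completed.
have tha0 : `[t, t + h]%classic `<=` `[0, a]%classic.
  move=> s /=; rewrite !in_itv/= => /andP[ts st].
  by rewrite (le_trans t0 ts) (le_trans st).
have int1 : \int[mu]_(s in [set t]) psi s = 0.
  have /(measurable_int mu) psit : mu.-integrable [set t] (EFin \o psi).
    by apply: integrableS (isub _ tha0) => //; rewrite e2; left.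
  have mu_t : mu [set t] = 0%E by exact: (lebesgue_measure_set1 t).
  by rewrite /Rintegral (null_set_integral mt psit mu_t).
rewrite e1 e2 !Rintegral_setU// ?int1 ?add0r//.
- by rewrite -e2; exact: isub.
- apply/disj_setPS => s [/= -> ]; by rewrite in_itv/= ltxx.
- by rewrite -e1; apply: isub; apply: subset_itv; rewrite bnd_simp.
- apply/disj_setPS => s [/=]; rewrite !in_itv/= => /andP[_ +] /andP[+ _].
  by move=> /le_lt_trans/[apply]; rewrite ltxx.
Qed.

Lemma integrableD_cst1 (a : R) (c : R -> R) :
  mu.-integrable `[0, a] (EFin \o c) ->
  mu.-integrable `[0, a] (fun t => (c t + 1)%:E).
Proof.
move=> ic.
have mJ : completed `[0, a]%classic.
  by apply: measurable_completed; exact: measurable_itv.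
have i1 : mu.-integrable `[0, a] (fun=> 1%E).
  apply/integrableP; split => //.
  case: (leP 0 a) => a0; last by rewrite set_itv_ge ?integral_set0// bnd_simp -ltNge.
  rewrite (eq_integral (fun=> 1%:E)); last by move=> t _; rewrite abse1.
  by rewrite integral_cst_completed// ltry.
have := integrableD mJ ic i1; apply: eq_integrable => // t _.
Qed.

(** The sum counts integers of [[0, c]]: if the last index [m] of the inductive step counts, the [m]
    earlier terms add up to at most [m <= c]. *)
Lemma sum_superlevel_le (c : R) m : 0 <= c ->
  \sum_(n < m) (n%:R <= c)%R%:R <= c + 1.
Proof.
move=> c0; have le_card k : \sum_(n < k) (n%:R <= c)%R%:R <= k%:R :> R.
  rewrite -[X in _ <= X%:R]card_ord -sumr_const.
  by apply: ler_sum => n _; rewrite lern1 leq_b1.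
elim: m => [|m IHm]; first by rewrite big_ord0 addr_ge0.
rewrite big_ord_recr/=; case: (leP m%:R c) => mc; last by rewrite addr0.
by rewrite lerD// (le_trans (le_card m)).
Qed.

(** Layer-cake bound: the measures are integrals of indicators, to whose sum [sum_superlevel_le]
    applies pointwise. *)
Lemma sum_measure_superlevel_le (a : R) (c : R -> R) m : L1_plus a c ->
  (\sum_(n < m) mu [set t | t \in `[0%R, a]%R /\ (n%:R <= c t)%R] <=
   \int[mu]_(t in `[0%R, a]) (c t + 1)%:E)%E.
Proof.
move=> [c0 ic].
have mJ : completed `[0, a]%classic.
  by apply: measurable_completed; exact: measurable_itv.
have mc := measurable_int mu ic; move/measurable_EFinP in mc.
pose E n := `[0, a]%classic `&` c @^-1` `[n%:R, +oo[%classic.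
have mE n : completed (E n).
  by apply: mc => //; exact: measurable_itv.
have EE n : [set t | t \in `[0, a] /\ (n%:R <= c t)%R] = E n.
  by apply/seteqP; split => t; rewrite /E /= [c t \in _]in_itv/= andbT.
under eq_bigr do rewrite EE.
have intE n : mu (E n) = (\int[mu]_(t in `[0%R, a]) (\1_(E n) t)%:E)%E.
  by rewrite integral_indic//; congr (mu _); apply/esym/setIidPl => t [].
under eq_bigr do rewrite intE.
rewrite -(ge0_integral_sum mu mJ); last 2 first.
- by move=> n; apply/measurable_EFinP; exact: measurable_indic.
- by move=> n t _; rewrite lee_fin.
apply: (@ge0_le_integral _ _ _ mu _ mJ).
- by move=> t _; apply: sume_ge0 => n _; rewrite lee_fin.
- apply: emeasurable_sum => n; apply/measurable_EFinP; exact: measurable_indic.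
- apply/measurable_EFinP; exact: measurable_funD.
- move=> t tJ; rewrite sumEFin lee_fin.
  apply: le_trans (sum_superlevel_le m (c0 t tJ)); apply: ler_sum => n _.
  rewrite indicE; case: (boolP (t \in E n)); last by rewrite ler0n.
  by rewrite inE /E /= [c t \in _]in_itv/= andbT => -[_ ->].
Qed.

(* The growth is needed at every [t], whereas [\int_(0, t) c] only provides it
   almost everywhere. As in the Vitali-Caratheodory theorem, [c] is replaced by
   a lower semicontinuous majorant, the sum of the indicators of open sets [U n]
   containing [{c >= n}] and of measure at most [mu {c >= n} + 2 ^- n.+1]. *)
Lemma L1_plus_growth (a : R) (c : R -> R) : L1_plus a c ->
  exists r : R -> R, [/\ forall t, 0 <= r t,
    forall s t, s <= t -> r s <= r t &
    forall t, t \in `[0, a[ -> exists2 d, 0 < d &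
      forall h, 0 < h < d -> h * c t <= r (t + h) - r t].
Proof.
move=> Lc; have [c0 ic] := Lc.
pose E (n : nat) := [set t | t \in `[0, a] /\ n%:R <= c t].
have /choice[U UP] : forall n, exists U : set R, [/\ open U, E n `<=` U &
    (mu U <= mu (E n) + (1 / (2 ^ n.+1)%:R)%:E)%E].
  by move=> n; apply: outer_measure_open_le; rewrite divr_gt0// ltr0n expn_gt0.
have mU n : completed (U n).
  by apply: measurable_completed; apply: open_measurable; case: (UP n).
have mitv (i : interval R) : completed [set` i].
  by apply: measurable_completed; exact: measurable_itv.
(* The integral over [[0, t]] of the majorant; [r] will be its real value. *)
pose S (t : R) := (\sum_(0 <= n <oo) mu (U n `&` `[0%R, t]%classic))%E.
have S_ge0 (t : R) : (0 <= S t)%E by apply: nneseries_ge0.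
have S_fin (t : R) : S t \is a fin_num.
  (* The sets [E n] contribute at most the integral of [c + 1], the excesses at most [1] by a
     geometric series. *)
  rewrite ge0_fin_numE//.
  apply: (@le_lt_trans _ _ (\sum_(0 <= n <oo) (mu (E n) + (1 / (2 ^ n.+1)%:R)%:E))%E).
    apply: lee_nneseries => // n _; have [_ _] := UP n; apply: le_trans.
    by apply: le_measure; rewrite ?inE//; apply: measurableI.
  apply: le_lt_trans (epsilon_trick _ _ _) _ => //.
  apply: lte_add_pinfty; last by rewrite ltry.
  apply: (@le_lt_trans _ _ (\int[mu]_(t in `[0%R, a]) (c t + 1)%:E)%E).
    apply: lime_le; first exact: is_cvg_nneseries.
    apply: nearW => m; rewrite big_mkord; exact: sum_measure_superlevel_le.
  by apply: integrable_lty => //; exact: integrableD_cst1.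
have S_le (s t : R) : s <= t -> (S s <= S t)%E.
  move=> st; apply: lee_nneseries => // n _; apply: le_measure; rewrite ?inE//.
  - by apply: measurableI.
  - by apply: measurableI.
  - by apply: setIS; apply: subset_itv; rewrite bnd_simp.
exists (fine \o S); split => /= [t|s t st|t].
- exact: fine_ge0.
- by rewrite fine_le// S_le.
rewrite in_itv/= => /andP[t0 ta].
have tJ : t \in `[0, a] by rewrite in_itv/= t0 ltW.
(* As [N - 1 <= c t < N], a whole neighbourhood of [t] lies in [U n] for every [n < N]. Each of
   these sets adds [h] to the growth of [S], and [h * N >= h * c t]. *)
set N := (Num.truncn (c t)).+1.
have /andP[Nc cN] := truncn_itv (c0 _ tJ); rewrite -/N in cN.
have tU : \forall s \near t, forall n : 'I_N, U n s.
  apply: (@filter_forall R 'I_N (fun n => U n) (nbhs t) _) => n.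
  apply: open_nbhs_nbhs; split; first by case: (UP n).
  have [_ EU _] := UP n; apply: EU; split => //.
  by rewrite (le_trans _ Nc)// ler_nat -ltnS.
have /nbhs_ballP[d /= d0 dU] := tU; exists d => // h /andP[h0 hd].
apply: (@le_trans _ _ (h * N%:R)); first by rewrite ler_pM2l// ltW.
rewrite lerBrDl -lee_fin EFinD !fineK// /S.
rewrite (nneseries_split 0 N)// [leRHS](nneseries_split 0 N)// addeAC.
have th : t <= t + h by rewrite lerDl ltW.
have JU (s : R) n : completed (U n `&` `[0, s]%classic) by exact: measurableI.
apply: leeD; last first.
  apply: lee_nneseries => // n _; apply: le_measure; rewrite ?inE//.
  by apply: setIS; apply: subset_itv; rewrite bnd_simp.
rewrite !big_mkord.
have -> : (h * N%:R)%:E = (\sum_(n < N) h%:E)%E.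
  by rewrite sumEFin sumr_const card_ord mulr_natr.
rewrite -big_split/=; apply: lee_sum => n _.
have <- : mu `]t, t + h]%classic = h%:E.
  rewrite -[LHS]/(lebesgue_measure `]t, t + h]%classic) lebesgue_measure_itv/=.
  by rewrite lte_fin ltrDl h0 -EFinB addrAC subrr add0r.
rewrite -measureU//; last first.
  apply/seteqP; split => // s [/= [_]]; rewrite !in_itv/= => /andP[_ +] /andP[+ _].
  by move=> /le_lt_trans/[apply]; rewrite ltxx.
apply: le_measure; rewrite ?inE//; first exact: measurableU.
move=> s [[Us]|]; rewrite /= !in_itv/= => /andP[s1 s2].
  by split => //; rewrite s1 (le_trans s2).
split; last by rewrite s2 (le_trans t0 (ltW s1)).
apply: dU; rewrite -ball_normE/= ltr_norml; apply/andP; split; lra.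
Qed.


End growth.

(** * Measurability of the restricted graph *)

Section measurability.
Context {R : realType} {X : completeNormedModType R}.

(** The complement of the tube is a countable union of rectangles, whose first factors are intervals
    because [rho] is nondecreasing. *)
Lemma lebesgue_borel_setD_tube (a : R) (rho : R -> R) (p : X) (G : set (R * X)) :
  (forall s t, 0 <= s -> s <= t -> t <= a -> rho s <= rho t) ->
  G `<=` `[0, a] `*` [set: X] -> lebesgue_borel a G ->
  lebesgue_borel a [set q | G q /\ `|q.2 - p| <= rho q.1].
Proof.
move=> rho_mono GJ mG; pose J := `[0, a]%classic `*` [set: X].
(* [rho t < `|x - p|] iff some rational [q] satisfies [rho t <= q < `|x - p|] *)
pose T (q : rat) := [set t | t \in `[0, a] /\ rho t <= ratr q] `*`
  [set x : X | ratr q < `|x - p|].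
have mT q : lebesgue_borel a (T q).
  apply: sub_sigma_algebra; exists [set t | t \in `[0, a] /\ rho t <= ratr q].
    split; first by move=> t [].
    exists [set t | t \in `[0, a] /\ rho t <= ratr q]; last first.
      by exists set0; [exact: negligible_set0|rewrite setU0].
    apply: is_interval_measurable => s t [] /=; rewrite !in_itv/=.
    move=> /andP[s0 sa] rs [/andP[t0 ta] rt] u /andP[su ut].
    have ua : u <= a by rewrite (le_trans ut).
    rewrite in_itv/= (le_trans s0 su) ua; split => //.
    by rewrite (le_trans _ rt) ?rho_mono ?(le_trans s0).
  exists [set x : X | ratr q < `|x - p|] => //; apply: sub_sigma_algebra.
  apply: (@open_comp _ _ (fun x : X => `|x - p|) [set r | ratr q < r]);
    last exact: open_gt.
  move=> x _; apply: cvg_norm; apply: cvgB; [exact: cvg_id|exact: cvg_cst].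
pose F n := if unpickle n is Some q then T q else set0.
have mF : lebesgue_borel a (\bigcup_n F n).
  apply: sigma_algebra_bigcup => n; rewrite /F; case: unpickle => [q|]; first exact: mT.
  exact: sigma_algebra0.
have mGC := sigma_algebraCD mG.
(* [G] minus the union of the [F n], written with countable unions and complements relative to
   [J]. *)
have -> : [set q | G q /\ `|q.2 - p| <= rho q.1] =
    J `\` \bigcup_n (bigcup2 (J `\` G) (\bigcup_n F n)) n.
  apply/seteqP; split => [[t x] /= [Gtx le_rho]|[t x] /= [Jtx notF]].
    split; first exact: GJ.
    rewrite bigcup2E => -[[]//|[n _]]; rewrite /F; case: unpickle => // q [/= [_ rq]].
    by move=> /lt_le_trans /(_ le_rho) /(le_lt_trans rq); rewrite ltxx.
  rewrite bigcup2E in notF; have Gtx : G (t, x).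
    by apply: contrapT => nG; apply: notF; left.
  split=> //; rewrite leNgt; apply/negP => /rat_in_itvoo[q].
  rewrite in_itv/= => /andP[/ltW rq qx]; apply: notF; right.
  exists (pickle q); first exact: I.
  by rewrite /F pickleK; split; [split; [case: Jtx|]|].
apply: sigma_algebraCD; apply: sigma_algebra_bigcup => -[|[|n]]//=.
exact: sigma_algebra0.
Qed.
End measurability.

(** The shape of the final [gamma]: [k] will bound [1 + |x|] on the tube, and [psi] serves the
    exceptional times. *)
Lemma L1_plusMD {R : realType} (a k : R) (c psi : R -> R) : 0 <= k ->
  L1_plus a c -> L1_plus a psi -> L1_plus a (fun t => c t * k + psi t).
Proof.
move=> k0 [c0 ic] [psi0 ipsi]; split.
  by move=> t tJ; rewrite addr_ge0 ?mulr_ge0 ?c0 ?psi0.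
have mJ : (@wlength R idfun)^*%mu.-cara.-measurable `[0, a]%classic.
  by apply: measurable_completed; exact: measurable_itv.
have := integrableD mJ (integrableZr mJ k ic) ipsi.
by apply: eq_integrable => // t _.
Qed.

(** * Restriction of the map to a growing tube *)

Theorem lemma4p1 (R : realType) (X : completeNormedModType R)
    (A : X -> set X) (hA : m_accretive A)
    (a : R) (ha : 0 < a)
    (K : R -> set X) (hK : forall t, t \in `[0, a] -> closed (K t))
    (hK0 : sect A K 0 !=set0)
    (hKleft : closed_from_left (gr a (sect A K)))
    (f : R -> X -> X)
    (D : set X) (hDK : D `<=` sect A K 0) (hD0 : D !=set0)
    (hDbnd : bounded_set D)
    (N : set R) (hN : lebesgue_measure.-negligible N) (hNJ : N `<=` `[0, a[)
    (c psi : R -> R) (hc : L1_plus a c) (hpsi : L1_plus a psi)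
    (hfc : forall t x, gr a (sect A K) (t, x) ->
       `|f t x| <= c t * (1 + `|x|))
    (hfT : forall t x, t \in `[0, a[ -> ~ N t -> sect A K t x ->
       tangent A K t x (f t x))
    (hNT : forall t x, N t -> sect A K t x -> weakly_tangent A K psi t x) :
  exists (K' : R -> set X) (gamma : R -> R),
    (forall t, t \in `[0, a] -> closed (K' t)) /\
    (forall t, t \in `[0, a] -> K' t `<=` K t) /\
    L1_plus a gamma /\
    D `<=` sect A K' 0 /\
    bounded_set (gr a K') /\
    (forall t x, gr a (sect A K') (t, x) -> `|f t x| <= gamma t) /\
    closed_from_left (gr a (sect A K')) /\
    (forall t x, t \in `[0, a[ -> ~ N t -> sect A K' t x ->
       tangent A K' t x (f t x)) /\
    (forall t x, N t -> sect A K' t x -> weakly_tangent A K' gamma t x) /\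
    (lebesgue_borel a (gr a (sect A K)) ->
       lebesgue_borel a (gr a (sect A K'))).
Proof.
have [accA _] := hA.
have [p [q Apq]] : op_dom A !=set0.
  by case: hK0 => x0 [_ /(_ _ filterT)[p [Ap _]]]; exists p.
have [M DM] : exists M, forall x, D x -> `|x| <= M.
  by case: hDbnd => M [_ hM]; exists (M + 1) => x; apply: hM; rewrite ltrDl.
have M0 : 0 <= M by case: hD0 => x /DM; apply: le_trans.
have [r [r0 r_mono r_grow]] := L1_plus_growth hc.
have [c0 ic] := hc; have [psi0 ipsi] := hpsi.
pose I (s t : R) := \int[completed_lebesgue_measure]_(u in `[s, t]) psi u.
have I_ge0 s t : 0 <= s -> t <= a -> 0 <= I s t.
  move=> s0 ta; apply: Rintegral_ge0 => u /=; rewrite in_itv/= => /andP[su ut].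
  by apply: psi0; rewrite in_itv/= (le_trans s0) ?(le_trans ut).
(* Multiplied by [E t], the increments of the three terms cover, in turn, the drift [h * |q|] with
   the approximation error, the slack [psi] allowed on [N], and [h * |f t x|]. *)
pose G t := t + I 0 t + r t.
(* [C >= 1 + |q|] absorbs drift and error; [C - (1 + |p|) >= M + |p|] puts [D] into the tube at time
   [0]. *)
pose C := 1 + M + 2 * `|p| + `|q|.
pose E t := C * expR (G t).
(* The subtracted constant turns membership in the tube into [1 + |x| <= E t], the factor in the
   growth bound on [f]. *)
pose rho t := E t - (1 + `|p|).
have p0 := normr_ge0 p; have q0 := normr_ge0 q.
have C0 : 0 <= C by rewrite /C; lra.
have G_ge0 t : 0 <= t -> t <= a -> 0 <= G t.
  by move=> t0 ta; rewrite !addr_ge0 ?r0 ?I_ge0.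
have E_ge t : 0 <= t -> t <= a -> C <= E t.
  move=> t0 ta; rewrite ler_peMr//; apply: le_trans (expR_ge1Dx _).
  by rewrite lerDl G_ge0.
have E_grow t h : 0 <= t -> 0 <= h -> t + h <= a ->
    E t * (h + I t (t + h) + (r (t + h) - r t)) <= E (t + h) - E t.
  move=> t0 h0 tha.
  set dG := h + _ + _.
  have GE : G (t + h) = G t + dG.
    by rewrite /G /dG /I (Rintegral_itv_cat ipsi)//; ring.
  rewrite /E GE expRD mulrA -[X in _ - X]mulr1 -mulrBr.
  apply: ler_wpM2l; first by rewrite mulr_ge0// expR_ge0.
  (* Convexity of [expR] gives the growth at every time, without differentiating [G]. *)
  by have := expR_ge1Dx dG; lra.
have E_mono s t : 0 <= s -> s <= t -> t <= a -> E s <= E t.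
  move=> s0 st ta; have sa : s <= a by rewrite (le_trans st).
  have st0 : 0 <= t - s by rewrite subr_ge0.
  have := E_grow s (t - s) s0 st0; rewrite [s + _]addrC subrK => /(_ ta) gr_st.
  rewrite -subr_ge0; apply: le_trans gr_st; apply: mulr_ge0.
    by rewrite (le_trans C0)// E_ge.
  apply: addr_ge0; last by rewrite subr_ge0 r_mono.
  by apply: addr_ge0 => //; exact: I_ge0.
have norm_tube t x : `|x - p| <= rho t -> 1 + `|x| <= E t.
  by have := ler_normD (x - p) p; rewrite subrK /rho; lra.
have tube_step t h x z y : closure (op_dom A) x -> 0 < h -> `|x - p| <= rho t ->
    rho t + h * (`|z| + `|q|) + `|semigroup A z h x - y| <= rho (t + h) ->
    `|y - p| <= rho (t + h).
  move=> clx h0 xp; apply: le_trans.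
  rewrite -(subrKA (semigroup A z h x)) (le_trans (ler_normD _ _))// addrC.
  rewrite (distrC y) lerD2r (le_trans (semigroup_dist z hA clx h0 Apq))//.
  by rewrite lerD// ler_pM2l// ler_normB.
have Ea_ge0 : 0 <= E a by rewrite (le_trans C0)// E_ge// ltW.
pose K' t := K t `&` [set x | `|x - p| <= rho t].
exists K', (fun t => c t * E a + psi t).
have f_le t x : gr a (sect A K') (t, x) -> `|f t x| <= c t * E t.
  move=> [/= tJ [[Ktx xp] clx]].
  by rewrite (le_trans (hfc _ _ _))// ler_wpM2l ?c0// norm_tube.
have gr_sub : gr a (sect A K') `<=` gr a (sect A K).
  by move=> [t x] [/= tJ [[Ktx _] clx]].
split; [|split; [|split; [|split; [|split; [|split; [|split; [|split; [|split]]]]]]]].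
- move=> t tJ; apply: closedI; first exact: hK.
  apply: (@closed_comp _ _ (fun x : X => `|x - p|) [set s | s <= rho t]).
    by move=> x _; apply: cvg_norm; apply: cvgB; [exact: cvg_id|exact: cvg_cst].
  exact: closed_le.
- by move=> t _ x [].
- exact: L1_plusMD.
- move=> x Dx; have [Kx clx] := hDK _ Dx; split => //; split => //=.
  have := E_ge 0 (lexx _) (ltW ha); have := ler_normB x p; have := DM _ Dx.
  rewrite /rho /C; lra.
- exists (a + E a + `|p|); split; first exact: num_real.
  move=> b /ltW bE [t x] [/= tJ [_ /= xp]].
  move: (tJ); rewrite in_itv/= => /andP[t0 ta].
  have := norm_tube _ _ xp; have := E_mono _ _ t0 ta (lexx _) => h1 h2.
  rewrite prod_normE/= ge_max ger0_norm//; apply/andP; split; lra.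
- move=> t x Ktx; have [/= tJ _] := Ktx.
  move: (tJ); rewrite in_itv/= => /andP[t0 ta].
  rewrite (le_trans (f_le _ _ Ktx))// (@le_trans _ _ (c t * E a))//.
    by rewrite ler_wpM2l ?c0// E_mono.
  by rewrite lerDl psi0.
- move=> t_ x_ t x t_nd t_cvg x_cvg Ktx.
  have [/= tJ [Kx clx]] := hKleft _ _ _ _ t_nd t_cvg x_cvg (fun n => gr_sub _ (Ktx n)).
  split => //; split => //; split => //=.
  (* Since [t_ n <= t] and [rho] is nondecreasing, every [x_ n] satisfies the bound with [rho t],
     which passes to the limit. *)
  have xp_cvg : `|x_ n - p| @[n --> \oo] --> `|x - p|.
    by apply: cvg_norm; apply: cvgB => //; exact: cvg_cst.
  apply: (cvgr_to_le xp_cvg); apply: nearW => n.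
  have [/= + [[_ /= xnp] _]] := Ktx n; rewrite in_itv/= => /andP[tn0 tna].
  rewrite (le_trans xnp)// lerD2r E_mono//.
    have tl : limn t_ = t by apply/cvg_lim.
    by rewrite -tl; apply: nondecreasing_cvgn_le => //; apply/cvg_ex; exists t.
  by move: tJ; rewrite in_itv/= => /andP[].
- move=> t x tJ nNt Kx; have [[Ktx /= xp] clx] := Kx.
  move: (tJ); rewrite in_itv/= => /andP[t0 ta].
  have tJc : t \in `[0, a] by rewrite in_itv/= t0 ltW.
  apply/tangentP => e d e0 d0.
  have [d' d'0 grow] := r_grow _ tJ.
  (* The error is capped at [h], so that the term [t] of [G] covers it; [d'] gives the growth of
     [r], and [a - t] keeps [t + h] below [a]. *)
  have e'0 : 0 < Num.min e 1 by rewrite lt_min e0/=.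
  have d''0 : 0 < Num.min d (Num.min d' (a - t)) by rewrite !lt_min d0 d'0 subr_gt0.
  have /tangentP /(_ _ _ e'0 d''0) := hfT _ _ tJ nNt (conj Ktx clx).
  move=> [h [y [/andP[h0]]]]; rewrite !lt_min ltrBrDl => /and3P[hd hd' hta] [Ky cly] Sy.
  exists h, y; split; [by rewrite h0| |]; last first.
    by rewrite (lt_le_trans Sy)// ler_pM2l// ge_min lexx.
  split => //; split => //=; apply: (tube_step _ _ _ (f t x)) xp _ => //.
  have Et := E_ge _ t0 (ltW ta); have Et0 := le_trans C0 Et.
  have EI := mulr_ge0 Et0 (I_ge0 _ _ t0 (ltW hta)).
  have hf : h * `|f t x| <= E t * (r (t + h) - r t).
    rewrite (le_trans (ler_wpM2l (ltW h0) (f_le _ _ (conj tJc Kx))))//.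
    by rewrite mulrA mulrC ler_wpM2l// grow// h0.
  have hq : h * (1 + `|q|) <= h * E t.
    rewrite ler_pM2l// (le_trans _ Et)// /C; lra.
  have Sy1 : `|semigroup A (f t x) h x - y| <= h.
    by rewrite (le_trans (ltW Sy))// ler_piMr ?(ltW h0)// ge_min lexx orbT.
  have := E_grow _ _ t0 (ltW h0) (ltW hta); rewrite /rho; lra.
- move=> t x Nt Kx; have [[Ktx /= xp] clx] := Kx.
  have tJ := hNJ _ Nt; move: (tJ); rewrite /= in_itv/= => /andP[t0 ta].
  apply/(weakly_tangentP _ _ _ (L1_plusMD Ea_ge0 hc hpsi)) => // e d e0 d0.
  have e'0 : 0 < Num.min e 1 by rewrite lt_min e0/=.
  have /(weakly_tangentP _ _ _ hpsi tJ) /(_ _ _ e'0 d0) := hNT _ _ Nt (conj Ktx clx).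
  move=> [h [y [/andP[h0 hd] tha [Ky cly] Sy]]].
  exists h, y; split => //; first by rewrite h0.
    split => //; split => //=; apply: (tube_step _ _ _ 0) xp _ => //.
    have Et := E_ge _ t0 (ltW ta); have Et1 : 1 + `|q| <= E t.
      by rewrite (le_trans _ Et)// /C; lra.
    have hq : h * (1 + `|q|) <= h * E t by rewrite ler_pM2l.
    have EI : I t (t + h) <= E t * I t (t + h).
      by rewrite ler_peMl ?I_ge0 ?(ltW tha)// (le_trans _ Et1)// lerDl.
    (* With zero forcing, only the monotonicity of [r] enters. *)
    have Er : 0 <= E t * (r (t + h) - r t).
      apply: mulr_ge0 (le_trans C0 Et) _.
      by rewrite subr_ge0 r_mono// lerDl ltW.
    have he : h * Num.min e 1 <= h.
      by rewrite ler_piMr ?(ltW h0)// ge_min lexx orbT.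
    have := E_grow _ _ t0 (ltW h0) (ltW tha); move: Sy; rewrite -/(I t (t + h)).
    rewrite normr0 /rho; lra.
  (* The slack [psi] is at most [gamma]. *)
  rewrite (lt_le_trans Sy)// lerD//; last by rewrite ler_pM2l// ge_min lexx.
  have sub_int g : completed_lebesgue_measure.-integrable `[0, a] (EFin \o g) ->
      completed_lebesgue_measure.-integrable `[t, t + h] (EFin \o g).
    apply: integrableS; try by apply: measurable_completed; exact: measurable_itv.
    by apply: subset_itv; rewrite bnd_simp // ltW.
  apply: le_Rintegral.
  - by apply: measurable_completed; exact: measurable_itv.
  - exact: sub_int.
  - by apply: sub_int; case: (L1_plusMD Ea_ge0 hc hpsi).
  move=> u /=; rewrite in_itv/= => /andP[tu uth].
  rewrite lerDr mulr_ge0// c0// in_itv/= (le_trans t0)//.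
  by rewrite (le_trans uth)// ltW.
- move=> mK; rewrite [X in lebesgue_borel a X](_ : _ =
    [set u | gr a (sect A K) u /\ `|u.2 - p| <= rho u.1]).
    apply: lebesgue_borel_setD_tube mK => [s t s0 st ta|[t x] []//].
    by rewrite lerD2r E_mono.
  by apply/seteqP; split=> -[t x]; [move=> [? [[? ?] ?]]|move=> [[? [? ?]] ?]].
Qed.
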